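(* Every tree-cograph $G$ is b-continuous; that is, $G$ admits a b-coloring with exactly $t$ colors for every integer $t$ with $\chi(G)\le t\le \chi_b(G)$.
   Context: Graphs are finite and simple. For vertex-disjoint graphs $G_1=(V_1,E_1)$ and $G_2=(V_2,E_2)$, the union is $G_1\cup G_2=(V_1\cup V_2,E_1\cup E_2)$, and the join $G_1\vee G_2$ is obtained from the union by adding all edges between $V_1$ and $V_2$. A co-tree is a graph whose complement is a tree. Tree-cographs are defined recursively: a graph $G$ is a tree-cograph if and only if (i) $G$ is a tree or a co-tree, or (ii) $G$ is the union of two tree-cographs, or (iii) $G$ is the join of two tree-cographs. A b-coloring of a graph with $t$ colors is a proper coloring of the vertices with $t$ colors such that every color class contains a vertex that is adjacent to all other $t-1$ color classes. $\chi(G)$ is the chromatic number, and the b-chromatic number $\chi_b(G)$ is the maximum $t$ such that $G$ admits a b-coloring with $t$ colors. *)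

(* Defs.v *)
From mathcomp Require Import all_boot.

Set Implicit Arguments.
Unset Strict Implicit.
Unset Printing Implicit Defensive.

Record sgraph := SGraph {
  vertex :> finType;
  edge : rel vertex;
  edge_sym : symmetric edge;
  edge_irrefl : irreflexive edge }.

Definition iso (G H : sgraph) : Prop :=
  exists2 f : G -> H, bijective f & forall x y, edge (f x) (f y) = edge x y.

Definition compl_rel (G : sgraph) : rel G :=
  fun x y => (x != y) && ~~ edge x y.

Lemma compl_sym (G : sgraph) : symmetric (@compl_rel G).
Proof. by move=> x y; rewrite /compl_rel eq_sym edge_sym. Qed.

Lemma compl_irrefl (G : sgraph) : irreflexive (@compl_rel G).
Proof. by move=> x; rewrite /compl_rel eqxx. Qed.

Definition compl (G : sgraph) : sgraph :=
  SGraph (@compl_sym G) (@compl_irrefl G).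

Definition union_rel (G1 G2 : sgraph) : rel (G1 + G2)%type :=
  fun u v => match u, v with
  | inl x, inl y => edge x y
  | inr x, inr y => edge x y
  | _, _ => false
  end.

Lemma union_sym (G1 G2 : sgraph) : symmetric (@union_rel G1 G2).
Proof. by move=> [x|x] [y|y] //=; rewrite edge_sym. Qed.

Lemma union_irrefl (G1 G2 : sgraph) : irreflexive (@union_rel G1 G2).
Proof. by move=> [x|x] /=; rewrite edge_irrefl. Qed.

Definition union (G1 G2 : sgraph) : sgraph :=
  SGraph (@union_sym G1 G2) (@union_irrefl G1 G2).

Definition join_rel (G1 G2 : sgraph) : rel (G1 + G2)%type :=
  fun u v => match u, v with
  | inl x, inl y => edge x y
  | inr x, inr y => edge x y
  | _, _ => true
  end.

Lemma join_sym (G1 G2 : sgraph) : symmetric (@join_rel G1 G2).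
Proof. by move=> [x|x] [y|y] //=; rewrite edge_sym. Qed.

Lemma join_irrefl (G1 G2 : sgraph) : irreflexive (@join_rel G1 G2).
Proof. by move=> [x|x] /=; rewrite edge_irrefl. Qed.

Definition join (G1 G2 : sgraph) : sgraph :=
  SGraph (@join_sym G1 G2) (@join_irrefl G1 G2).

Definition connected (G : sgraph) : Prop :=
  forall x y : G, connect (@edge G) x y.

(* [ucycle] also accepts the empty sequence and a single edge traversed back
   and forth; the graph-theoretic cycles are those with at least 3 vertices. *)
Definition acyclic (G : sgraph) : Prop :=
  forall c : seq G, ucycle (@edge G) c -> size c < 3.

(* A tree has at least one vertex. *)
Definition is_tree (G : sgraph) : Prop :=
  [/\ 0 < #|G|, connected G & acyclic G].

Definition is_cotree (G : sgraph) : Prop := is_tree (compl G).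

(* [union] and [join] live on the sum of the vertex types, so "G is the union
   (or join) of G1 and G2", for vertex-disjoint G1 and G2, is expressed up to
   isomorphism. *)
Inductive tree_cograph : sgraph -> Prop :=
| tree_cograph_tree G : is_tree G -> tree_cograph G
| tree_cograph_cotree G : is_cotree G -> tree_cograph G
| tree_cograph_union G G1 G2 :
    tree_cograph G1 -> tree_cograph G2 -> iso (union G1 G2) G -> tree_cograph G
| tree_cograph_join G G1 G2 :
    tree_cograph G1 -> tree_cograph G2 -> iso (join G1 G2) G -> tree_cograph G.

Definition proper_coloring (G : sgraph) t (f : {ffun G -> 'I_t}) : bool :=
  [forall x, forall y, edge x y ==> (f x != f y)].

Definition b_vertex (G : sgraph) t (f : {ffun G -> 'I_t}) (x : G) : bool :=
  [forall c, (c != f x) ==> [exists y, edge x y && (f y == c)]].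

Definition b_coloring (G : sgraph) t (f : {ffun G -> 'I_t}) : bool :=
  proper_coloring f && [forall c, exists x, (f x == c) && b_vertex f x].

(* Color classes may be empty here, which does not affect the minimum [chi];
   the classes of a b-coloring are nonempty by definition. *)
Definition colorable (G : sgraph) t : bool :=
  [exists f : {ffun G -> 'I_t}, proper_coloring f].

Definition b_colorable (G : sgraph) t : bool :=
  [exists f : {ffun G -> 'I_t}, b_coloring f].

Lemma colorable_card (G : sgraph) : colorable G #|G|.
Proof.
apply/existsP; exists [ffun x => enum_rank x].
apply/forallP=> x; apply/forallP=> y; apply/implyP=> xy.
rewrite !ffunE; apply: contraTneq xy => /enum_rank_inj->.
by rewrite edge_irrefl.
Qed.

Definition chi (G : sgraph) : nat :=
  ex_minn (ex_intro (colorable G) _ (colorable_card G)).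

Lemma b_colorable_card (G : sgraph) t : b_colorable G t -> t <= #|G|.
Proof.
case/existsP=> f /andP[_ /forallP fP]; rewrite -[t in t <= _]card_ord.
apply: leq_trans (leq_image_card f G); apply/subset_leq_card/subsetP=> c _.
by have /existsP[x /andP[/eqP<- _]] := fP c; apply/imageP; exists x.
Qed.

(* The range of [t] loses nothing, by [b_colorable_card]. *)
Definition chi_b (G : sgraph) : nat :=
  \max_(t < #|G|.+1 | b_colorable G t) t.

Definition b_continuous (G : sgraph) : Prop :=
  forall t : nat, chi G <= t <= chi_b G ->
    exists f : {ffun G -> 'I_t}, b_coloring f.

(* Main.v *)
(** By descent on [t], it suffices that a b-coloring with [t + 1] colors can be
    turned into one with [t] colors whenever the graph is [t]-colorable.

    A proper coloring having a class without b-vertex loses that class at no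
    cost, so for a union it is enough to permute the colors of one side; a
    b-coloring of a join consists of b-colorings of its two sides.

    The color classes of a co-tree are the vertices and edges of a matching of
    the tree, and the b-colorings are the matchings without augmenting path of
    length 1 or 3. Augmenting along a shortest augmenting path creates no
    shorter one, whence a b-coloring with one color less.

    A b-coloring of a tree with [t + 1] colors provides more than [t] vertices
    of degree at least [t]. Order the vertices from such a vertex [r], every
    vertex having at most one earlier neighbour, give distinct colors to the
    first [t] of these vertices, choose for each of them the colors of its later
    neighbours so that it becomes a b-vertex, and color the rest greedily. *)
Require Import Defs.
From mathcomp Require Import all_boot.
From mathcomp Require Import perm.

Set Implicit Arguments.
Unset Strict Implicit.
Unset Printing Implicit Defensive.

(** * Colorings and b-vertices *)

Section Colorings.
Variables (G : sgraph) (C : finType).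
Implicit Types (f : G -> C) (x y : G) (c : C).

(** Colors come from any finite type, since joins and co-trees use subtypes and sums as palettes. *)
Definition is_proper f := forall x y, edge x y -> f x != f y.

Definition b_vert f x :=
  [forall c, (c != f x) ==> [exists y, edge x y && (f y == c)]].

(** A proper coloring is a b-coloring exactly when this set is full; its size measures how close a
    coloring comes to that. *)
Definition b_colors f : {set C} := [set f x | x : G & b_vert f x].

Lemma b_vertP f x :
  reflect (forall c, c != f x -> exists2 y, edge x y & f y = c) (b_vert f x).
Proof.
apply: (iffP forallP) => [H c cx|H c].
  by have /implyP/(_ cx)/existsP[y /andP[xy /eqP yc]] := H c; exists y.
by apply/implyP=> /H[y xy <-]; apply/existsP; exists y; rewrite xy eqxx.
Qed.

Lemma b_colorsP f c :
  reflect (exists2 x, b_vert f x & f x = c) (c \in b_colors f).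
Proof.
apply: (iffP imsetP) => [[x]|[x bx <-]]; first by rewrite inE => bx ->; exists x.
by exists x; rewrite ?inE.
Qed.

End Colorings.

Lemma b_colors_bij (G : sgraph) (C D : finType) (f : G -> C) (h : C -> D) :
  bijective h -> b_colors (h \o f) = h @: b_colors f.
Proof.
move=> bij_h; have inj_h := bij_inj bij_h; have [k hK kK] := bij_h.
have bE x : b_vert (h \o f) x = b_vert f x.
  apply/b_vertP/b_vertP=> H c cx.
    have [|y xy /inj_h] := H (h c); last by exists y.
    by rewrite /= inj_eq.
  have [|y xy yc] := H (k c); last by exists y; rewrite //= yc kK.
  by apply: contraNneq cx => kc; rewrite /= -kc kK.
apply/setP=> d; apply/b_colorsP/imsetP => [[x]|[c /b_colorsP[x bx <-] ->]].
  by rewrite bE => bx <-; exists (f x) => //; apply/b_colorsP; exists x.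
by exists x; rewrite ?bE.
Qed.

Lemma proper_inj (G : sgraph) (C D : finType) (f : G -> C) (h : C -> D) :
  injective h -> is_proper f -> is_proper (h \o f).
Proof. by move=> inj_h f_prop x y /f_prop; rewrite /= (inj_eq inj_h). Qed.

Lemma colorableP (G : sgraph) t :
  reflect (exists f : G -> 'I_t, is_proper f) (colorable G t).
Proof.
apply: (iffP existsP) => [[f /forallP f_prop]|[f f_prop]].
  by exists f => x y; have /forallP/(_ y)/implyP := f_prop x.
exists [ffun x => f x]; apply/forallP=> x; apply/forallP=> y; apply/implyP.
by rewrite !ffunE; apply: f_prop.
Qed.

Lemma b_colorableP (G : sgraph) t :
  reflect (exists2 f : G -> 'I_t, is_proper f & b_colors f = setT)
          (b_colorable G t).
Proof.
apply: (iffP existsP) => [[f /andP[/forallP f_prop /forallP f_b]]|].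
  exists f => [x y|]; first by have /forallP/(_ y)/implyP := f_prop x.
  apply/setP=> c; rewrite inE; apply/b_colorsP.
  by have /existsP[x /andP[/eqP<- bx]] := f_b c; exists x.
case=> f f_prop f_b; exists [ffun x => f x]; apply/andP; split.
  apply/forallP=> x; apply/forallP=> y; apply/implyP.
  by rewrite !ffunE; apply: f_prop.
apply/forallP=> c; apply/existsP; have: c \in b_colors f by rewrite f_b inE.
case/b_colorsP=> x /b_vertP bx <-; exists x; rewrite ffunE eqxx /=.
apply/forallP=> d; rewrite ffunE; apply/implyP=> /bx[y xy <-].
by apply/existsP; exists y; rewrite xy ffunE eqxx.
Qed.

Lemma b_colorable_fin (G : sgraph) (C : finType) (f : G -> C) :
  is_proper f -> b_colors f = setT -> b_colorable G #|C|.
Proof.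
move=> f_prop f_b; apply/b_colorableP; exists (@enum_rank C \o f).
  by apply: proper_inj f_prop; apply: enum_rank_inj.
rewrite b_colors_bij; last exact: enum_rank_bij.
apply/setP=> c; rewrite f_b [RHS]inE.
by apply/imsetP; exists (enum_val c); rewrite ?enum_valK ?inE.
Qed.

Lemma colorable_leq (G : sgraph) s t :
  s <= t -> colorable G s -> colorable G t.
Proof.
move=> st /colorableP[f f_prop]; apply/colorableP.
exists (widen_ord st \o f); apply: proper_inj f_prop => i j /(congr1 val) /= ij.
exact: val_inj.
Qed.

(* A vertex of a class without b-vertex misses some other color, and can take
   it; the class being stable, all its vertices can do so simultaneously. *)
Lemma recolor (G : sgraph) t (f : G -> 'I_t.+1) c :
  is_proper f -> c \notin b_colors f ->
  exists2 g : G -> 'I_t, is_proper g & #|b_colors f| <= #|b_colors g|.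
Proof.
move=> f_prop cNb.
(* [lift c] identifies the [t] new colors with the old ones other than [c]; [d] stands for the old
   color of [x], or for one that [x] misses when [x] has color [c]. *)
have/fin_all_exists[g gP] x : exists d : 'I_t,
    (f x != c -> lift c d = f x) /\
    (f x = c -> forall y, edge x y -> f y != lift c d).
  have [fxc|fxc] := eqVneq (f x) c; last first.
    have [|d fxd _] := @unlift_some _ c (f x); first by rewrite eq_sym.
    by exists d; split=> // fxE; rewrite fxE eqxx in fxc.
  have : ~~ b_vert f x by apply: contra cNb => bx; apply/b_colorsP; exists x.
  rewrite negb_forall => /existsP[e]; rewrite negb_imply fxc => /andP[ec eN].
  have [|d eE _] := @unlift_some _ c e; first by rewrite eq_sym.
  exists d; split=> [/eqP//|_ y xy]; apply: contra eN => /eqP yd; apply/existsP; exists y.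
  by rewrite xy yd -eE eqxx.
have gE x : f x != c -> lift c (g x) = f x by case: (gP x).
have gN x y : f x = c -> edge x y -> f y != lift c (g x).
  by move=> fx; case: (gP x) => _; apply.
exists g => [x y xy|].
  apply/eqP=> gxy; have fxy := f_prop _ _ xy.
  have [fx|fx] := eqVneq (f x) c.
    have := gN _ _ fx xy; rewrite gxy gE ?eqxx //.
    by rewrite -fx eq_sym.
  have [fy|fy] := eqVneq (f y) c.
    by have := gN y x fy; rewrite edge_sym -gxy gE // eqxx => /(_ xy).
  by rewrite -(gE x) // gxy gE // eqxx in fxy.
rewrite -(card_imset (mem (b_colors g)) (@lift_inj _ c)).
apply/subset_leq_card/subsetP=> d df; have := df.
case/b_colorsP=> x /b_vertP bx fx.
have fxc : f x != c by rewrite fx; apply: contraTneq df => ->.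
rewrite -fx -gE //; apply: imset_f; apply/b_colorsP; exists x => //.
apply/b_vertP=> e eg; have [|y xy yE] := bx (lift c e).
  by rewrite -gE // (inj_eq lift_inj).
exists y => //; apply: (@lift_inj _ c); rewrite gE ?yE //.
by rewrite eq_sym neq_lift.
Qed.

Definition b_step (G : sgraph) :=
  forall t, colorable G t -> b_colorable G t.+1 -> b_colorable G t.

Lemma b_step_continuous (G : sgraph) : b_step G -> b_continuous G.
Proof.
move=> stepG t /andP[chi_t t_chi].
have col_t : colorable G t.
  by apply: colorable_leq chi_t _; rewrite /chi; case: ex_minnP.
suff /existsP : b_colorable G t by [].
(* With no color at all, a proper coloring is vacuously a b-coloring. A positive lower bound on
   [chi_b] means that the maximum is attained by some [s]. *)
case: t {chi_t} t_chi col_t => [_ /colorableP[f f_prop]|t].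
  by apply/b_colorableP; exists f => //; apply/setP; case.
move=> t_chi col_t; have [s bs ts] : exists2 s, b_colorable G s & t < s.
  pose A := [pred s : 'I_#|G|.+1 | b_colorable G s].
  have [noA|A_gt0] := posnP #|A|.
    by move: t_chi; rewrite /chi_b big_pred0 // => s; have := card0_eq noA s.
  have [s bs sE] := eq_bigmax_cond (fun s : 'I_#|G|.+1 => nat_of_ord s) A_gt0.
  by exists s; [exact: bs | rewrite -sE].
elim: s bs ts => // s IHs bs; rewrite ltnS leq_eqVlt => /predU1P[->|ts] //.
by apply: IHs => //; apply: stepG => //; apply: colorable_leq col_t.
Qed.

(** If every color has a b-vertex, the descent property yields all [t] colors; otherwise [recolor]
    removes a color without b-vertex. *)
Lemma recolor_step (G : sgraph) t n (f : G -> 'I_t.+1) :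
  b_step G -> colorable G t -> is_proper f -> n <= t -> n <= #|b_colors f| ->
  exists2 g : G -> 'I_t, is_proper g & n <= #|b_colors g|.
Proof.
move=> stepG col_t f_prop n_le nf.
have [fT|] := eqVneq (b_colors f) setT.
  have bt : b_colorable G t.+1 by apply/b_colorableP; exists f.
  have /b_colorableP[g g_prop gT] := stepG t col_t bt.
  by exists g; rewrite // gT cardsT card_ord.
rewrite -subTset => /subsetPn[c _ cN].
by have [g g_prop fg] := recolor f_prop cN; exists g => //; apply: leq_trans fg.
Qed.

Lemma proper_iso (G H : sgraph) (C : finType) (h : H -> G) (f : G -> C) :
  (forall x y, edge (h x) (h y) = edge x y) -> is_proper f -> is_proper (f \o h).
Proof. by move=> hE f_prop x y; rewrite -hE => /f_prop. Qed.

Lemma b_colors_iso (G H : sgraph) (C : finType) (h : H -> G) (f : G -> C) :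
  bijective h -> (forall x y, edge (h x) (h y) = edge x y) ->
  b_colors (f \o h) = b_colors f.
Proof.
case=> k hK kK hE; apply/setP=> c; apply/b_colorsP/b_colorsP=> [][x /b_vertP bx xc].
  exists (h x) => //; apply/b_vertP=> d /bx[y xy <-].
  by exists (h y); rewrite ?hE.
exists (k x); rewrite /= ?kK //; apply/b_vertP=> d /=; rewrite kK => /bx[y xy <-].
by exists (k y); rewrite -?hE ?kK.
Qed.

Lemma iso_b_step (G H : sgraph) : iso G H -> b_step G -> b_step H.
Proof.
case=> h bij_h hE stepG t /colorableP[f f_prop] /b_colorableP[g g_prop gT].
have [k hK kK] := bij_h.
have kE x y : edge (k x) (k y) = edge x y by rewrite -hE !kK.
have col_t : colorable G t.
  by apply/colorableP; exists (f \o h); apply: proper_iso.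
have bt : b_colorable G t.+1.
  apply/b_colorableP; exists (g \o h); first exact: proper_iso.
  by rewrite b_colors_iso.
have /b_colorableP[f' f'_prop f'T] := stepG t col_t bt.
apply/b_colorableP; exists (f' \o k); first exact: proper_iso.
by rewrite b_colors_iso //; exists h.
Qed.

(** Take [s] maximizing the union. If a color [c] were missed and some [e] hit twice, composing [s]
    with the transposition of [c] and [e] would gain [c] and lose nothing. *)
Lemma perm_union_card (C : finType) (A B : {set C}) :
  exists s : {perm C}, minn #|C| (#|A| + #|B|) <= #|A :|: s @: B|.
Proof.
case: (@arg_maxnP {perm C} 1%g predT (fun s => #|A :|: s @: B|)) => // s _ s_max.
exists s; rewrite leqNgt leq_min -{1}cardsT; apply/negP=> /andP[ltC ltAB].
have [c cN] : exists c, c \notin A :|: s @: B.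
  have: ~~ ([set: C] \subset A :|: s @: B).
    by apply: contraTN ltC => /subset_leq_card; rewrite -leqNgt.
  by case/subsetPn=> c _ cN; exists c.
have [e eA /imsetP[b bB eE]] : exists2 e, e \in A & e \in s @: B.
  suff: A :&: s @: B != set0 by case/set0Pn=> e /setIP[]; exists e.
  apply: contraTneq ltAB => AB0; have := cardsUI A (s @: B).
  by rewrite AB0 cards0 addn0 -leqNgt (card_imset _ perm_inj) => ->.
have := s_max (s * tperm c e)%g isT; apply/negP; rewrite -ltnNge.
suff sub : c |: (A :|: s @: B) \subset A :|: (s * tperm c e)%g @: B.
  by apply: leq_trans (subset_leq_card sub); rewrite cardsU1 cN.
apply/subsetP=> d /setU1P[->|].
  by apply/setUP; right; apply/imsetP; exists b; rewrite // permM -eE tpermR.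
case/setUP=> [dA|/imsetP[b' b'B dE]]; first by rewrite inE dA.
have [->|de] := eqVneq d e; first by rewrite inE eA.
rewrite inE; apply/orP; right; apply/imsetP; exists b' => //.
rewrite permM -dE tpermD // eq_sym //; apply: contraNneq cN => <-.
by rewrite inE dE imset_f ?orbT.
Qed.

(** * Unions and joins *)

Definition glue (A B C : Type) (f : A -> C) (g : B -> C) (u : A + B) : C :=
  match u with inl x => f x | inr y => g y end.

Lemma b_colors_union (G1 G2 : sgraph) (C : finType) (f : union G1 G2 -> C) :
  b_colors f = b_colors (fun x => f (inl x)) :|: b_colors (fun x => f (inr x)).
Proof.
apply/setP=> c; apply/b_colorsP/setUP.
  move=> [[x|x] /b_vertP bx xc]; [left|right]; apply/b_colorsP; exists x => //;
  apply/b_vertP=> d dx; have [[y|y] // xy yd] := bx d dx; by exists y.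
case=> /b_colorsP[x /b_vertP bx xc].
  exists (inl x : union G1 G2) => //; apply/b_vertP=> d /bx[y xy yd].
  by exists (inl y : union G1 G2).
exists (inr x : union G1 G2) => //; apply/b_vertP=> d /bx[y xy yd].
by exists (inr y : union G1 G2).
Qed.

(** Each side drops to [t] colors, keeping its number of b-colors up to the cap [t]. These numbers
    added up to at least [t + 1], so the capped ones reach [t], and a permutation spreads them over
    all colors. *)
Lemma b_step_union (G1 G2 : sgraph) :
  b_step G1 -> b_step G2 -> b_step (union G1 G2).
Proof.
move=> step1 step2 t /colorableP[h h_prop] /b_colorableP[f f_prop fT].
pose f1 x := f (inl x); pose f2 x := f (inr x).
have fE : b_colors f = b_colors f1 :|: b_colors f2.
  exact: b_colors_union.
have [||||g1 g1_prop g1_ge] := @recolor_step G1 t (minn t #|b_colors f1|) f1 step1.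
- by apply/colorableP; exists (fun x => h (inl x)) => x y /(h_prop (inl x) (inl y)).
- by move=> x y /(f_prop (inl x) (inl y)).
- exact: geq_minl.
- exact: geq_minr.
have [||||g2 g2_prop g2_ge] := @recolor_step G2 t (minn t #|b_colors f2|) f2 step2.
- by apply/colorableP; exists (fun x => h (inr x)) => x y /(h_prop (inr x) (inr y)).
- by move=> x y /(f_prop (inr x) (inr y)).
- exact: geq_minl.
- exact: geq_minr.
have [s s_ge] := perm_union_card (b_colors g1) (b_colors g2).
apply/b_colorableP; exists (glue g1 (s \o g2)) => [[x|x] [y|y] // /[dup] xy|].
- exact: g1_prop.
- by move/g2_prop; rewrite /= (inj_eq perm_inj).
apply/eqP; rewrite b_colors_union [X in _ :|: X](_ : _ = s @: b_colors g2); last first.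
  exact: (@b_colors_bij _ _ _ g2 s (Bijective (permK s) (permKV s))).
rewrite eqEcard subsetT cardsT; apply: leq_trans s_ge.
rewrite leq_min leqnn card_ord /=; apply: leq_trans (leq_add g1_ge g2_ge).
have : t.+1 <= #|b_colors f1| + #|b_colors f2|.
  by apply: leq_trans (leq_card_setU _ _); rewrite -fE fT cardsT card_ord.
case: (leqP t #|b_colors f1|) => [_|_ le_t]; first by rewrite leq_addr.
case: (leqP t #|b_colors f2|) => _; first by rewrite leq_addl.
exact: ltnW.
Qed.

Lemma colorable_fin (G : sgraph) (C : finType) (f : G -> C) :
  is_proper f -> colorable G #|C|.
Proof.
move=> f_prop; apply/colorableP; exists (@enum_rank C \o f).
by apply: proper_inj f_prop; apply: enum_rank_inj.
Qed.

(** The two sides use disjoint palettes, so a b-vertex meets the colors of its own palette within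
    its own side. *)
Lemma join_split (G1 G2 : sgraph) t (f : join G1 G2 -> 'I_t) : is_proper f ->
  exists a b, [/\ a + b = t, colorable G1 a, colorable G2 b &
    b_colors f = setT -> b_colorable G1 a /\ b_colorable G2 b].
Proof.
(* Colors used on neither side go to the right palette, so that the sizes add up to [t]. *)
move=> f_prop; pose P := [set f (inl x) | x : G1].
have inlP x : f (inl x) \in P by apply: imset_f.
have inrP x : f (inr x) \notin P.
  apply/imsetP=> -[y _ xy]; have := f_prop (inr x) (inl y) isT.
  by rewrite xy eqxx.
pose f1 x : {c | c \in P} := exist (fun c => c \in P) _ (inlP x).
pose f2 x : {c | c \notin P} := exist (fun c => c \notin P) _ (inrP x).
have f1_prop : is_proper f1 by move=> x y /(f_prop (inl x) (inl y)).
have f2_prop : is_proper f2 by move=> x y /(f_prop (inr x) (inr y)).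
exists #|{: {c | c \in P}}|, #|{: {c | c \notin P}}|; split.
- by rewrite !card_sig /= cardC card_ord.
- exact: colorable_fin f1_prop.
- exact: colorable_fin f2_prop.
move=> fT; split.
  apply: (b_colorable_fin f1_prop); apply/setP=> -[c cP]; rewrite inE.
  have : c \in b_colors f by rewrite fT inE.
  case/b_colorsP=> -[x|x] /b_vertP bx xc; last by case/negP: (inrP x); rewrite xc.
  apply/b_colorsP; exists x; last exact: val_inj.
  apply/b_vertP=> -[d dP] dx; have [|[y|y] xy yd] := bx d; first exact: dx.
    by exists y => //; apply: val_inj.
  by case/negP: (inrP y); rewrite yd.
apply: (b_colorable_fin f2_prop); apply/setP=> -[c cP]; rewrite inE.
have : c \in b_colors f by rewrite fT inE.
case/b_colorsP=> -[x|x] /b_vertP bx xc; first by case/negP: cP; rewrite -xc.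
apply/b_colorsP; exists x; last exact: val_inj.
apply/b_vertP=> -[d dP] dx; have [|[y|y] xy yd] := bx d; first exact: dx.
  by case/negP: (dP); rewrite -yd.
by exists y => //; apply: val_inj.
Qed.

Lemma b_colorable_join (G1 G2 : sgraph) a b :
  b_colorable G1 a -> b_colorable G2 b -> b_colorable (join G1 G2) (a + b).
Proof.
case/b_colorableP=> f1 f1_prop f1T /b_colorableP[f2 f2_prop f2T].
pose f : join G1 G2 -> 'I_a + 'I_b := glue (inl \o f1) (inr \o f2).
rewrite -[a]card_ord -[b]card_ord -card_sum; apply: (@b_colorable_fin _ _ f).
  by move=> [x|x] [y|y] //=; [move/f1_prop | move/f2_prop].
have f1P c : exists2 x, b_vert f1 x & f1 x = c by apply/b_colorsP; rewrite f1T inE.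
have f2P c : exists2 x, b_vert f2 x & f2 x = c by apply/b_colorsP; rewrite f2T inE.
apply/setP=> c; rewrite inE; apply/b_colorsP; case: c => c.
  have [x /b_vertP bx <-] := f1P c; exists (inl x : join G1 G2) => //.
  apply/b_vertP=> -[d dx|d _].
    by have [|y xy <-] := bx d => //; exists (inl y : join G1 G2).
  by have [y _ <-] := f2P d; exists (inr y : join G1 G2).
have [x /b_vertP bx <-] := f2P c; exists (inr x : join G1 G2) => //.
apply/b_vertP=> -[d _|d dx].
  by have [y _ <-] := f1P d; exists (inl y : join G1 G2).
by have [|y xy <-] := bx d => //; exists (inr y : join G1 G2).
Qed.

(** Since [a' + b' = t] and [a + b = t + 1], either [a' < a] or [b' < b]; the descent is applied on
    that side alone. *)
Lemma b_step_join (G1 G2 : sgraph) :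
  b_step G1 -> b_step G2 -> b_step (join G1 G2).
Proof.
move=> step1 step2 t /colorableP[h /join_split[a' [b' [tE col1 col2 _]]]].
case/b_colorableP=> f /join_split[a [b [t1E _ _ fb]]] /fb[b1 b2].
have [a'a|aa'] := ltnP a' a.
  case: a a'a t1E b1 {fb} => // a a'a [<-] b1; apply: b_colorable_join b2.
  by apply: step1 => //; apply: colorable_leq col1.
have b'b : b' < b by rewrite -(ltn_add2l a) t1E ltnS -tE leq_add2r.
case: b b'b t1E b2 {fb} => // b b'b; rewrite addnS => -[<-] b2.
by apply: b_colorable_join b1 _; apply: step2 => //; apply: colorable_leq col2.
Qed.

(** * Alternating paths of two involutions *)

Section Involutions.
Variables (T : finType) (m n : T -> T).
Hypotheses (mK : involutive m) (nK : involutive n).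

Let step := m \o n.

Let step_inj : injective step.
Proof. exact: inj_comp (inv_inj mK) (inv_inj nK). Qed.

Let iter_step_inj k : injective (iter k step).
Proof. by elim: k => //= k IHk; apply: inj_comp step_inj IHk. Qed.

Let m_iter k y : iter k step (m (iter k step y)) = m y.
Proof.
elim: k y => // k IHk y; rewrite iterSr iterS /step /= mK nK -/step.
exact: IHk.
Qed.

(** Iterating [m \o n] alone suffices: when [m x = x], this orbit is stable under [m] and under [n]
    separately. *)
Definition alternating (x : T) : {set T} := [set y | fconnect step x y].

Lemma alternating_id x : x \in alternating x.
Proof. by rewrite inE connect0. Qed.

Lemma alternating_trans x y z :
  z \in alternating x -> z \in alternating y -> x \in alternating y.
Proof.
rewrite !inE => xz yz; apply: connect_trans yz _.
by rewrite fconnect_sym.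
Qed.

Lemma alternating_m x y : m x = x -> y \in alternating x -> m y \in alternating x.
Proof.
move=> mx; rewrite !inE => /iter_findex yE; set k := findex _ _ _ in yE.
by rewrite (fconnect_sym step_inj) -[x in fconnect _ _ x]mx -(m_iter k x) yE fconnect_iter.
Qed.

Lemma alternating_n x y : m x = x -> y \in alternating x -> n y \in alternating x.
Proof.
move=> mx xy; rewrite -[n y]mK; apply: alternating_m => //.
by move: xy; rewrite !inE => /connect_trans->//; apply: (fconnect1 step).
Qed.

(** A fixed point of [m] or [n] at [iter k step x] amounts to a return time [2k] or [2k + 1]. Being
    below twice the order, it is the order itself or [0]. *)
Let order_eq x k : iter k step x = x -> 0 < k < (order step x).*2 ->
  k = order step x.
Proof.
move=> kx /andP[k_gt0 k_lt].
have iter0 i : i < order step x -> iter i step x = x -> i = 0.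
  by move=> i_lt ix; rewrite -(findex_iter i_lt) ix findex0.
have [k_lt1|le_k] := ltnP k (order step x).
  by rewrite (iter0 _ k_lt1 kx) in k_gt0.
have k0 : k - order step x = 0.
  apply: iter0; first by rewrite ltn_subLR // addnn.
  by apply: (@iter_step_inj (order step x)); rewrite -iterD subnKC // iter_order.
by apply/eqP; rewrite eqn_leq le_k -subn_eq0 k0.
Qed.

Let fix_m x k : m x = x -> m (iter k step x) = iter k step x <->
  iter k.*2 step x = x.
Proof.
move=> mx; rewrite -addnn iterD; split=> [mk|kx].
  by rewrite -[X in iter k step X]mk m_iter.
by apply: (@iter_step_inj k); rewrite m_iter kx.
Qed.

Let fix_n x k : m x = x -> n (iter k step x) = iter k step x <->
  iter k.*2.+1 step x = x.
Proof.
move=> mx; have -> : n (iter k step x) = m (iter k.+1 step x) by rewrite /= mK.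
rewrite -addnn -addSn iterD; split=> [mk|kx].
  by rewrite -[X in iter k.+1 step X]mk m_iter.
by apply: (@iter_step_inj k.+1); rewrite m_iter kx.
Qed.

(* The orbit of [x] under [m] and [n] is the vertex set of an alternating path
   starting at [x]: it ends either at a fixed point [y] of [m], or at a fixed
   point [z] of [n]. As [m] conjugates [m \o n] to its inverse, it acts on the
   orbit as a reflection, and the parity of the size decides between the two. *)
Lemma alternating_end x : m x = x ->
  (exists y, [/\ y != x, y \in alternating x,
     forall w, w \in alternating x -> (m w == w) = (w == x) || (w == y) &
     forall w, w \in alternating x -> n w != w]) \/
  (exists z, [/\ z \in alternating x,
     forall w, w \in alternating x -> (m w == w) = (w == x) &
     forall w, w \in alternating x -> (n w == w) = (w == z)]).
Proof.
move=> mx; set N := order step x.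
have inP w : w \in alternating x -> exists2 k, k < N & w = iter k step x.
  rewrite inE => xw; exists (findex step x w); first exact: findex_max.
  by rewrite iter_findex.
have iterP k : iter k step x \in alternating x by rewrite inE fconnect_iter.
have N_gt0 : 0 < N by apply: order_gt0.
have iter_eq k l : k < N -> l < N -> iter k step x = iter l step x -> k = l.
  by move=> kN lN kl; rewrite -(findex_iter kN) kl findex_iter.
have mP k : k < N -> m (iter k step x) = iter k step x -> k = 0 \/ k.*2 = N.
  case: k => [|k] kN; first by left.
  by move/(fix_m _ mx) => kx; right; apply: order_eq kx _; rewrite double_gt0 ltn_double.
have nP k : k < N -> n (iter k step x) = iter k step x -> k.*2.+1 = N.
  by move=> kN /(fix_n _ mx) kx; apply: order_eq kx _; rewrite /= ltn_Sdouble.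
have [oddN|evenN] := boolP (odd N).
  have NE : N./2.*2.+1 = N by rewrite -[RHS]odd_double_half oddN.
  right; exists (iter N./2 step x); split=> // w /inP[k kN ->]; apply/eqP/eqP.
  - by case/(mP _ kN)=> [->//|kE]; rewrite -kE odd_double in oddN.
  - by move->.
  - by move/(nP _ kN); rewrite -{1}NE => -[/double_inj->].
  by move->; apply/fix_n => //; rewrite NE iter_order.
have NE : N./2.*2 = N by rewrite -[RHS]odd_double_half (negPf evenN).
have half_lt : N./2 < N.
  by rewrite -{2}NE -addnn -{1}[N./2]addn0 ltn_add2l -double_gt0 NE.
left; exists (iter N./2 step x); split=> // [|w /inP[k kN ->]|w /inP[k kN ->]].
- apply/eqP=> /(iter_eq _ 0 half_lt N_gt0) N0.
  by rewrite -NE N0 in N_gt0.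
- apply/eqP/orP=> [/(mP _ kN)[->|kE]|[]/eqP->//].
  + by left.
  + by right; rewrite -kE doubleK.
  by apply/fix_m => //; rewrite NE iter_order.
by apply/eqP=> /(nP _ kN) kE; rewrite -kE /= odd_double in evenN.
Qed.

(* If every alternating path started at a fixed point of [m] ended at a fixed
   point of [n], then the end would determine the start. *)
Lemma alternating_augmenting :
  #|[pred x | n x == x]| < #|[pred x | m x == x]| ->
  exists x y, [/\ m x = x, y != x, y \in alternating x,
     forall w, w \in alternating x -> (m w == w) = (w == x) || (w == y) &
     forall w, w \in alternating x -> n w != w].
Proof.
move=> lt_nm; pose A x := [exists y in alternating x, n y == y].
have [/existsP[x /andP[/eqP mx xA]]|] := boolP [exists x, (m x == x) && ~~ A x].
  have [[y [yx yS mS nS]]|[z [zS _ nS]]] := alternating_end mx.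
    by exists x, y.
  by case/negP: xA; apply/existsP; exists z; rewrite zS nS /=.
rewrite negb_exists => /forallP allA.
have /fin_all_exists[g gP] x : exists z,
    m x = x -> z \in alternating x /\ n z = z.
  have [mx|mx] := eqVneq (m x) x; last by exists x => mx'; rewrite mx' eqxx in mx.
  have := allA x; rewrite mx eqxx /= negbK => /existsP[z /andP[zS /eqP nz]].
  by exists z.
have g_inj : {in [pred x | m x == x] &, injective g}.
  move=> x y; rewrite !inE => /eqP mx /eqP my gxy.
  have [xS nx] := gP x mx; have [yS ny] := gP y my.
  have xy : x \in alternating y by apply: alternating_trans xS _; rewrite gxy.
  have [[_ [_ _ _ nS]]|[_ [_ mS _]]] := alternating_end my.
    by have := nS _ yS; rewrite ny eqxx.
  by have := mS x xy; rewrite mx eqxx => /esym/eqP.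
move: lt_nm; rewrite ltnNge -(card_in_imset g_inj); case/negP.
apply/subset_leq_card/subsetP=> _ /imsetP[x + ->]; rewrite !inE => /eqP/gP[_ ->].
exact: eqxx.
Qed.

End Involutions.

(** * Augmenting matchings *)

Section Matchings.
Variables (T : finType) (H : rel T).
Hypothesis H_sym : symmetric H.
Implicit Types (m n : T -> T) (S : {set T}).

(* A matching is encoded as the involution exchanging the ends of each of its
   edges; its fixed points are the unmatched vertices. *)
Definition matching m := involutive m /\ forall x, m x != x -> H x (m x).

(* No augmenting path of length 1 or 3; in the latter case [p] and [q] may
   coincide, which makes a triangle. *)
Definition no_short_path m :=
  (forall p q, m p = p -> m q = q -> ~~ H p q) /\
  (forall u p q, m u != u -> m p = p -> m q = q -> ~~ (H u p && H (m u) q)).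

(** Only the sets of unmatched vertices are compared; the augmenting path itself is not recorded. *)
Definition augments m n x y :=
  [/\ m x = x, m y = y, x != y &
    forall z, (n z == z) = [&& m z == z, z != x & z != y]].

(** Its cardinal replaces the length of the augmenting path as the decreasing measure. *)
Definition diff m n := [set z | m z != n z].

Definition switch S m n z := if z \in S then n z else m z.

Lemma involutive_closedC m S z :
  involutive m -> (forall w, w \in S -> m w \in S) -> z \notin S -> m z \notin S.
Proof. by move=> mK mS; apply: contra => /mS; rewrite mK. Qed.

Lemma matching_switch m n S : matching m -> matching n ->
    (forall z, z \in S -> m z \in S) -> (forall z, z \in S -> n z \in S) ->
  matching (switch S m n).
Proof.
move=> [mK mH] [nK nH] mS nS; split=> z; rewrite /switch.
  have [zS|zS] := boolP (z \in S); first by rewrite nS // nK.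
  by rewrite (negPf (involutive_closedC mK mS zS)) mK.
by case: ifP => _; [apply: nH | apply: mH].
Qed.

Lemma augments_switch m n S x y :
    m x = x -> x \in S -> m y = y -> y \in S -> x != y ->
    (forall z, z \in S -> (m z == z) = (z == x) || (z == y)) ->
    (forall z, z \in S -> n z != z) ->
  augments m (switch S m n) x y.
Proof.
move=> mx xS my yS xy mS nS; split=> // z; rewrite /switch.
case: ifPn => zS; first by rewrite (negPf (nS z zS)) mS // -negb_or andbN.
have zx : z != x by apply: contraNneq zS => ->.
have zy : z != y by apply: contraNneq zS => ->.
by rewrite zx zy !andbT.
Qed.

Lemma exists_augments m n : matching m -> matching n ->
    #|[pred x | n x == x]| < #|[pred x | m x == x]| ->
  exists n' x y, matching n' /\ augments m n' x y.
Proof.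
move=> mM nM /(alternating_augmenting mM.1 nM.1)[x [y [mx yx yS mS nS]]].
exists (switch (alternating m n x) m n), x, y; split.
  apply: matching_switch => // z.
    exact: alternating_m mM.1 nM.1 _ _ mx.
  exact: alternating_n mM.1 nM.1 _ _ mx.
apply: augments_switch => //; rewrite ?alternating_id //; last by rewrite eq_sym.
by apply/eqP; rewrite mS // eqxx orbT.
Qed.

Definition cut u v n z := if (z == u) || (z == v) then z else n z.

Lemma matching_cut n u : matching n -> matching (cut u (n u) n).
Proof.
move=> [nK nH]; split=> z; rewrite /cut.
  have [zu|zu] := boolP ((z == u) || (z == n u)); first by rewrite zu.
  by rewrite inv_eq // (inj_eq (inv_inj nK)) orbC (negPf zu) nK.
by case: ifPn => _; [rewrite eqxx | apply: nH].
Qed.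

(* [S] carries an alternating path from [x] to [u]; leaving it at [u] for the
   unmatched neighbour [p] augments [m] by a path that avoids [n u] and [y]. *)
Lemma reroute m n x y u p S :
    matching m -> matching n -> augments m n x y ->
    n u != u -> n p = p -> H u p -> m u != u -> m (n u) != n u -> m u != n u ->
    x \in S -> u \in S -> n u \notin S ->
    (forall z, z \in S -> m z \in S) ->
    (forall z, z \in S -> z != u -> n z \in S /\ n z != z) ->
    (forall z, z \in S -> (m z == z) = (z == x)) ->
  exists n' x' y',
    [/\ matching n', augments m n' x' y' & #|diff m n'| < #|diff m n|].
Proof.
move=> mM nM [mx my xy nE] nu np up mu mnu munu xS uS nuNS mSS nSS mS.
have [mK mH] := mM; have [nK nH] := nM.
have /and3P[/eqP mp px py] : [&& m p == p, p != x & p != y] by rewrite -nE np.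
have pNS : p \notin S by apply: contra px => /mS <-; rewrite mp.
have yNS : y \notin S by apply: contra xy => /mS; rewrite my eqxx eq_sym.
have pu : p != u by apply: contraNneq nu => <-; rewrite np.
have nS z : z \in S -> z != u -> [/\ n z \in S, n z != u & n z != z].
  move=> zS zu; have [nzS nz] := nSS z zS zu; split=> //.
  by apply: contraNneq nuNS => <-; rewrite nK.
pose n' z := if z == u then p else if z == p then u else switch S m n z.
have n'u : n' u = p by rewrite /n' eqxx.
have n'p : n' p = u by rewrite /n' (negPf pu) eqxx.
have n'S z : z \in S -> z != u -> n' z = n z.
  move=> zS zu; rewrite /n' (negPf zu) /switch zS.
  by have -> : (z == p) = false by apply: contraNF pNS => /eqP <-.
have n'NS z : z \notin S -> z != p -> n' z = m z.
  move=> zS zp; rewrite /n' /switch (negPf zS) (negPf zp).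
  by have -> : (z == u) = false by apply: contraNF zS => /eqP ->.
exists n', x, p; split.
- split=> z.
    have [->|zu] := eqVneq z u; first by rewrite n'u n'p.
    have [->|zp] := eqVneq z p; first by rewrite n'p n'u.
    have [zS|zS] := boolP (z \in S).
      by have [nzS nzu _] := nS z zS zu; rewrite !n'S // nK.
    rewrite n'NS // n'NS ?mK // ?involutive_closedC //.
    by rewrite inv_eq // mp.
  have [->|zu] := eqVneq z u; first by rewrite n'u.
  have [->|zp] := eqVneq z p; first by rewrite n'p H_sym.
  have [zS|zS] := boolP (z \in S); first by rewrite n'S //; apply: nH.
  by rewrite n'NS //; apply: mH.
- split=> //; first by rewrite eq_sym.
  move=> z; have [->|zu] := eqVneq z u.
    by rewrite n'u (negPf pu) (negPf mu).
  have [->|zp] := eqVneq z p; first by rewrite n'p eq_sym (negPf pu) !andbF.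
  have [zS|zS] := boolP (z \in S).
    have [_ _ nz] := nS z zS zu.
    by rewrite n'S // (negPf nz) mS // andbA andbN.
  rewrite n'NS // (contraNneq _ zS) ?andbT // => ->; exact: xS.
have nuy : n u != y by apply: contraNneq mnu => ->; rewrite my.
have ny : n y != y by rewrite nE eqxx !andbF.
(* At most [p] enters while [n u] and [y] leave, so the difference shrinks. *)
have sub : diff m n' \subset p |: (diff m n :\ n u :\ y).
  apply/subsetP=> z; have [->|zp] := eqVneq z p; first by rewrite setU11.
  rewrite !inE (negPf zp) /=; have [->|zu] := eqVneq z u.
    move=> _; rewrite munu andbT; apply/andP; split.
      by apply: contraNneq mu => ->; rewrite my.
    by rewrite eq_sym.
  have [zS|zS] := boolP (z \in S); last by rewrite n'NS // eqxx.
  rewrite n'S // => ->; rewrite andbT; apply/andP; split.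
    by apply: contraNneq yNS => <-.
  by apply: contraNneq nuNS => <-.
apply: leq_ltn_trans (subset_leq_card sub) _.
have nuD : n u \in diff m n by rewrite inE nK (inv_eq mK) eq_sym.
have yD : y \in diff m n :\ n u by rewrite !inE eq_sym nuy my eq_sym.
rewrite cardsU1 (cardsD1 (n u) (diff m n)) nuD (cardsD1 y (diff m n :\ n u)) yD.
by case: (p \notin _); rewrite ?add0n !add1n ?ltnS ?leqnSn.
Qed.

(** A short path for [n] runs through [p], [u], [n u], [q]. Delete the edge from [u] to [n u] and
    follow the alternating path from [x]. If it ends unmatched by [m], it avoids [u] and gives a
    smaller difference; if it ends at [u] or [n u], it is rerouted to [p] or [q]. *)
Lemma shorten m n x y : matching m -> no_short_path m -> matching n ->
    augments m n x y ->
  no_short_path n \/ exists n' x' y',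
    [/\ matching n', augments m n' x' y' & #|diff m n'| < #|diff m n|].
Proof.
move=> mM [m1 m2] nM aug; have [mx my xy nE] := aug.
have nm z : n z = z -> m z = z by move/eqP; rewrite nE => /and3P[/eqP].
pose bad (w : T * T * T) := let: (u, p, q) := w in
  [&& n u != u, n p == p, n q == q, H u p & H (n u) q].
have [/existsP[[[u p] q]]|] := boolP [exists w, bad w]; last first.
  rewrite negb_exists => /forallP good; left; split=> [p q /nm mp /nm mq|u p q].
    exact: m1.
  move=> nu np nq; have := good (u, p, q).
  by rewrite /bad nu np nq !eqxx.
case/and5P=> nu /eqP np /eqP nq up nuq; right.
have [mK mH] := mM; have [nK nH] := nM.
have nnu : n (n u) != n u by rewrite nK eq_sym.
have munm z r : n r = r -> H z r -> m z != z.
  by move=> /nm mr zr; apply/eqP=> mz; have := m1 _ _ mz mr; rewrite zr.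
have mu := munm _ _ np up; have mnu := munm _ _ nq nuq.
have munu : m u != n u.
  by apply/eqP=> muE; have := m2 u p q mu (nm _ np) (nm _ nq); rewrite muE up nuq.
have mnuu : m (n u) != u by rewrite inv_eq // eq_sym.
have uy : u != y by apply: contraNneq mu => ->; rewrite my.
have nuy : n u != y by apply: contraNneq mnu => ->; rewrite my.
have cM := matching_cut u nM.
have cE z : (cut u (n u) n z == z) = [|| z == u, z == n u | n z == z].
  by rewrite /cut; case: (z == u); case: (z == n u); rewrite //= eqxx.
have [] := alternating_end mM.1 cM.1 mx.
  case=> y' [y'x y'S mS nS]; set S := alternating _ _ _ in y'S mS nS.
  exists (switch S m (cut u (n u) n)), x, y'; split.
  - by apply: matching_switch => // z; [apply: alternating_m mM.1 cM.1 _ _ mx|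
       apply: alternating_n mM.1 cM.1 _ _ mx].
  - apply: augments_switch => //; rewrite ?alternating_id //; last by rewrite eq_sym.
    by apply/eqP; rewrite mS // eqxx orbT.
  have uNS : u \notin S by apply/negP=> /nS; rewrite cE eqxx.
  apply/proper_card/properP; split; last first.
    by exists u; rewrite inE ?munu // /switch (negPf uNS) eqxx.
  apply/subsetP=> z; rewrite !inE /switch; case: ifPn => [zS|_]; last by rewrite eqxx.
  by move: (nS z zS); rewrite cE /cut !negb_or => /and3P[/negPf-> /negPf-> _].
case=> z [zS mS cS]; set S := alternating _ _ _ in zS mS cS.
have xS : x \in S by apply: alternating_id.
have mSS w : w \in S -> m w \in S by apply: alternating_m mM.1 cM.1 _ _ mx.
have nSS w : w \in S -> w != z -> n w \in S /\ n w != w.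
  move=> wS wz; have : cut u (n u) n w \in S by apply: alternating_n mM.1 cM.1 _ _ mx _.
  have := cS w wS; rewrite cE (negPf wz) => /negbT/norP[wu /norP[wnu nw]].
  by rewrite /cut (negPf wu) (negPf wnu).
have : cut u (n u) n z == z by rewrite cS.
rewrite cE => /or3P[/eqP zu|/eqP znu|/eqP nz].
- rewrite {}zu in zS cS nSS; apply: (reroute (S := S) mM nM aug nu np up) => //.
  by apply: contra nu => nuS; rewrite -cS // cE eqxx orbT.
- rewrite {}znu in zS cS nSS.
  apply: (reroute (u := n u) (S := S) mM nM aug _ nq nuq) => //; rewrite ?nK //.
  by apply: contra nu => uS; rewrite eq_sym -cS // cE eqxx.
(* The end would be unmatched by [m] too, hence equal to [x], which [n] matches. *)
have /eqP zx : z == x by rewrite -mS // nm.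
by have := nE x; rewrite eqxx andbF -zx nz eqxx.
Qed.

Lemma augment m n : matching m -> no_short_path m -> matching n ->
    #|[pred x | n x == x]| < #|[pred x | m x == x]| ->
  exists n' x y, [/\ matching n', no_short_path n' & augments m n' x y].
Proof.
move=> mM mN nM /(exists_augments mM nM)[n0 [x [y [{}nM aug]]]] {n}.
have [d] := ubnP #|diff m n0|; elim: d n0 x y nM aug => // d IHd n x y nM aug le_d.
have [nN|[n' [x' [y' [n'M aug' lt_n']]]]] := shorten mM mN nM aug.
  by exists n, x, y.
by apply: IHd n'M aug' _; apply: leq_trans lt_n' _.
Qed.

End Matchings.

(** * Co-triangle-free graphs *)

Lemma augments_card (T : finType) (m n : T -> T) x y : augments m n x y ->
  #|[pred z | m z == z]| = #|[pred z | n z == z]|.+2.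
Proof.
move=> [mx my xy nE]; rewrite (cardD1 x) inE mx eqxx (cardD1 y) !inE my eqxx.
rewrite eq_sym xy !add1n; congr _.+2; apply: eq_card => z.
by rewrite !inE nE andbC -andbA andbCA.
Qed.

Section Representatives.
Variables (T : finType) (m : T -> T).
Hypothesis mK : involutive m.

(** One vertex of each matched pair and every fixed point of [m]: these index the color classes. *)
Definition reps := [set x | enum_rank x <= enum_rank (m x)].

Lemma repsN x : x \notin reps -> m x \in reps.
Proof. by rewrite !inE mK -ltnNge => /ltnW. Qed.

Lemma reps_eq x : x \in reps -> m x \in reps -> m x = x.
Proof.
rewrite !inE mK => le1 le2; apply: enum_rank_inj; apply: val_inj.
by apply/eqP; rewrite eqn_leq le1 le2.
Qed.

(** [m] carries the vertices outside [reps] bijectively to the representatives that it does not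
    fix. *)
Lemma card_reps : #|reps|.*2 = #|T| + #|[pred x | m x == x]|.
Proof.
have -> : #|[pred x | m x == x]| = #|reps :&: [set x | m x == x]|.
  by apply: eq_card => x; rewrite !inE andbC; case: eqP => //= ->; rewrite leqnn.
have : #|~: reps| = #|reps :\: [set x | m x == x]|.
  rewrite -(card_imset _ (inv_inj mK)); apply: eq_card => x.
  apply/imsetP/setDP => [[y]|[xr mx]].
    rewrite in_setC => yN ->; split; first exact: repsN.
    by rewrite inE mK; apply: contra yN => /eqP yE; rewrite inE -yE.
  exists (m x); rewrite ?mK // inE; apply/negP=> /(reps_eq xr) mxx.
  by rewrite inE mxx eqxx in mx.
move=> DE; rewrite -(cardsC reps) DE -addnn -addnA; congr (_ + _).
by rewrite addnC cardsID.
Qed.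

End Representatives.

Section CoTriangleFree.
Variable G : sgraph.
Hypothesis triangle_free : forall x y z : G,
  compl_rel x y -> compl_rel y z -> ~~ compl_rel x z.

(** A color class is a clique of the complement, so it has at most two vertices; the classes of size
    two form the matching. *)
Lemma coloring_matching (C : finType) (f : G -> C) : is_proper f ->
  exists m, [/\ matching (@compl_rel G) m,
    forall x y, f x = f y <-> y = x \/ y = m x &
    #|[set f x | x : G]|.*2 = #|G| + #|[pred x | m x == x]|].
Proof.
(* The default [x] makes the vertex of a singleton class a fixed point. *)
move=> f_prop; pose m x := odflt x [pick y | (y != x) && (f y == f x)].
have HI x y : f x = f y -> x != y -> compl_rel x y.
  move=> fxy xy; rewrite /compl_rel xy /=; apply/negP=> /f_prop.
  by rewrite fxy eqxx.
have mE x y : y != x -> f y = f x -> m x = y.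
  move=> yx fyx; rewrite /m; case: pickP => [z /andP[zx /eqP fzx]|/(_ y)]; last first.
    by rewrite yx fyx eqxx.
  apply/eqP; apply: contraTT (HI z x fzx zx) => zy.
  apply: (@triangle_free z y x); first by apply: HI; rewrite ?fyx.
  exact: HI.
have fm x : f (m x) = f x by rewrite /m; case: pickP => //= y /andP[_ /eqP].
have mK : involutive m.
  move=> x; have [mx|mx] := eqVneq (m x) x; first by rewrite !mx.
  by apply: mE; rewrite // eq_sym.
have fE x y : f x = f y <-> y = x \/ y = m x.
  split=> [fxy|[->//|->]]; last by rewrite fm.
  by have [->|yx] := eqVneq y x; [left | right; rewrite (mE x y)].
exists m; split=> //.
  by split=> // x mx; apply: HI; rewrite ?fm // eq_sym.
rewrite -card_reps //; congr _.*2.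
rewrite -(card_in_imset (f := f) (D := reps m)) => [|x y xr yr /fE[->//|yE]].
  apply: eq_card => c; apply/imsetP/imsetP=> -[x _ ->]; last by exists x.
  have [xr|xr] := boolP (x \in reps m); first by exists x.
  by exists (m x); rewrite ?fm // repsN.
by rewrite yE in yr *; rewrite (reps_eq mK xr yr).
Qed.

(** A b-vertex is adjacent to every other singleton class, so it has no unmatched neighbour in the
    complement. Each class contains such a vertex, which excludes both kinds of path. *)
Lemma b_coloring_no_short (C : finType) (f : G -> C) m :
  (forall x y, f x = f y <-> y = x \/ y = m x) -> involutive m ->
  b_colors f = setT -> no_short_path (@compl_rel G) m.
Proof.
move=> fE mK fT.
have fp x p : m p = p -> f x = f p -> x = p by move=> mp /esym/fE; rewrite mp => -[].
have bN x p : b_vert f x -> m p = p -> ~~ compl_rel x p.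
  move=> /b_vertP bx mp; rewrite /compl_rel; have [//|xp] := eqVneq x p.
  have [|y xy yp] := bx (f p).
    by apply: contraNneq xp => /esym/(fp _ _ mp) ->.
  by rewrite -(fp _ _ mp yp) xy.
have bP x : b_vert f x \/ b_vert f (m x).
  have /b_colorsP[y by_ yx] : f x \in b_colors f by rewrite fT inE.
  by move/esym/fE: yx by_ => [] ->; [left | right].
split=> [p q mp mq|u p q _ mp mq].
  by apply: bN mq; case: (bP p); rewrite ?mp.
by apply/negP=> /andP[up uq]; case: (bP u) => b; [move: up|move: uq]; apply/negP/bN.
Qed.

(** Conversely, a vertex without unmatched neighbour in the complement is a b-vertex: having no
    triangle, the complement cannot join it to both ends of a matched pair. *)
Lemma matching_b_coloring m t :
  matching (@compl_rel G) m -> no_short_path (@compl_rel G) m ->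
  t.*2 = #|G| + #|[pred x | m x == x]| -> b_colorable G t.
Proof.
move=> [mK mH] [m1 m2]; rewrite -card_reps // => /double_inj ->.
pose rep x := if x \in reps m then x else m x.
have repP x : rep x \in reps m by rewrite /rep; case: ifPn => // /(repsN mK).
pose f x : {r | r \in reps m} := exist (fun r => r \in reps m) _ (repP x).
have fm x : f (m x) = f x.
  apply: val_inj; rewrite /= /rep mK; case: ifPn => mxr; case: ifPn => // xr.
    exact: reps_eq.
  by case/negP: mxr; apply: repsN mK _ xr.
have fE x y : f x = f y -> y = x \/ y = m x.
  move/(congr1 val) => /=; rewrite /rep; case: ifP => _; case: ifP => _.
  - by left.
  - by move->; right; rewrite mK.
  - by right.
  by move/(inv_inj mK); left.
have fr r (rP : r \in reps m) : f r = exist _ r rP.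
  by apply: val_inj; rewrite /= /rep rP.
rewrite -(card_sig (mem (reps m))); apply: (@b_colorable_fin _ _ f).
  move=> x y xy; apply/eqP=> /fE[yx|yx]; first by rewrite yx edge_irrefl in xy.
  have [mx|mx] := eqVneq (m x) x; first by rewrite yx mx edge_irrefl in xy.
  by have := mH x mx; rewrite -yx /compl_rel xy andbF.
have bI x : (forall p, m p = p -> ~~ compl_rel x p) -> b_vert f x.
  move=> xN; apply/b_vertP=> -[s sP]; rewrite -fr => sx.
  have edgeI y : f y = f s -> ~~ compl_rel x y -> edge x y.
    move=> ys; rewrite negb_and !negbK => /orP[/eqP xy|//].
    by rewrite -ys xy eqxx in sx.
  have [ms|ms] := eqVneq (m s) s; first by exists s => //; apply/edgeI/xN.
  have [xs|xs] := boolP (compl_rel x s); last by exists s => //; apply: edgeI.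
  exists (m s); last exact: fm.
  by apply: edgeI (fm s) _; apply: triangle_free xs (mH s ms).
apply/setP=> -[r rP]; rewrite inE -fr; apply/b_colorsP.
(* If [r] has an unmatched neighbour [p] in the complement, the absence of short paths makes [m r]
   differ from [r] and have no such neighbour. *)
have [/existsP[p /andP[/eqP mp rp]]|] := boolP [exists p, (m p == p) && compl_rel r p].
  have mr : m r != r.
    by apply: contraTneq rp => mr; apply: m1.
  exists (m r); last exact: fm.
  by apply: bI => q mq; have := m2 r p q mr mp mq; rewrite rp.
rewrite negb_exists => /forallP rN; exists r => //; apply: bI => p mp.
by have := rN p; rewrite mp eqxx.
Qed.

(** Fewer classes mean fewer unmatched vertices, so [m] can be augmented; this removes two unmatched
    vertices, hence exactly one color. *)
Lemma b_step_cotriangle_free : b_step G.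
Proof.
move=> t /colorableP[g g_prop] /b_colorableP[f f_prop fT].
have [n [nM _ nE]] := coloring_matching g_prop.
have [m [mM fE mE]] := coloring_matching f_prop.
have im_f : #|[set f x | x : G]| = t.+1.
  rewrite -[RHS]card_ord -cardsT; congr #|pred_of_set _|.
  apply/eqP; rewrite eqEsubset subsetT -fT; apply/subsetP=> c /b_colorsP[x _ <-].
  exact: imset_f.
have im_g : #|[set g x | x : G]| <= t by rewrite -[leqRHS]card_ord max_card.
have lt_nm : #|[pred x | n x == x]| < #|[pred x | m x == x]|.
  by rewrite -(ltn_add2l #|G|) -nE -mE im_f ltn_double ltnS.
have mN := b_coloring_no_short fE mM.1 fT.
have [n' [x [y [n'M n'N aug]]]] := augment (@compl_sym G) mM mN nM lt_nm.
apply: matching_b_coloring n'M n'N _; apply/eqP.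
by rewrite -(eqn_add2r 2) -addnA !addn2 -(augments_card aug) -mE im_f.
Qed.

End CoTriangleFree.

(** * Trees *)

Definition unique_earlier (G : sgraph) (pos : G -> nat) :=
  forall x y z, edge x z -> edge y z -> pos x < pos z -> pos y < pos z -> x = y.

(** * Search order of a tree from a root *)

Section TreeOrder.
Variables (G : sgraph) (r : G).
Hypotheses (G_conn : connected G) (G_acyclic : acyclic G).

Let inner (s : seq G) := [rel x y : G | [&& edge x y, x \in s & y \in s]].

(** Otherwise a path from [a] to [b] within [s] closes up through [x] to a cycle, of at least three
    vertices since [a] and [b] differ. *)
Lemma unique_neighbour (s : seq G) a b x :
    (forall y, y \in s -> connect (inner s) r y) -> x \notin s ->
    a \in s -> b \in s -> edge a x -> edge b x -> a = b.
Proof.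
move=> s_conn xs sa sb ax bx; apply/eqP/negPn/negP=> ab.
have inner_sym : connect_sym (inner s).
  by apply: sym_connect_sym => y z /=; rewrite edge_sym [in RHS]andbCA andbA andbC andbA.
have : connect (inner s) a b.
  by apply: connect_trans (s_conn _ sb); rewrite inner_sym s_conn.
case/connectP=> p0 /shortenP[p p_path p_uniq _] bE {p0}.
have p_sub : {subset a :: p <= s}.
  elim: p a sa p_path {p_uniq bE ax ab} => [|c p IHp] a sa.
    by move=> _ y; rewrite inE => /eqP->.
  case/andP=> /and3P[_ _ cs] cp y; rewrite inE => /predU1P[->//|].
  exact: IHp.
have := G_acyclic (c := x :: a :: p); case: p => [|c p] in bE p_path p_uniq p_sub *.
  by rewrite bE eqxx in ab.
suff cyc : ucycle (@edge G) [:: x, a, c & p] by move=> /(_ cyc).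
apply/andP; split; last first.
  by rewrite cons_uniq p_uniq andbT; apply: contra xs => /p_sub.
rewrite [cycle _ _]/= rcons_path edge_sym ax /=.
rewrite -[last c p]/(last a (c :: p)) -bE bx andbT.
by apply: sub_path p_path => y z /and3P[].
Qed.

(** The list grows by a vertex adjacent to it, which exists by connectedness and has a single
    neighbour in the list by [unique_neighbour]. *)
Lemma grow_tree k : k < #|G| -> exists s,
  [/\ size s = k.+1, uniq s /\ head r s = r,
      forall y, y \in s -> connect (inner s) r y &
      forall x y z, z \in s -> edge x z -> edge y z ->
        index x s < index z s -> index y s < index z s -> x = y].
Proof.
elim: k => [_|k IHk k_lt].
  exists [:: r]; split=> // [y|x y z]; rewrite inE => /eqP-> //.
  by rewrite /= eqxx.
have [s [size_s [s_uniq s_head] s_conn s_ord]] := IHk (ltnW k_lt).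
have rs : r \in s by case: s size_s s_head {s_uniq s_conn s_ord} => //= a s _ ->; rewrite inE eqxx.
have [a [x [sa xs ax]]] : exists a x, [/\ a \in s, x \notin s & edge a x].
  have [y ys] : exists y, y \notin s.
    apply/existsP; rewrite -negb_forall; apply: contraL k_lt => /forallP sT.
    rewrite -leqNgt -size_s -(card_uniqP s_uniq); apply/subset_leq_card/subsetP=> y _.
    exact: sT.
  have [/existsP[a /andP[sa /existsP[x /andP[xs ax]]]]|] :=
      boolP [exists a in s, exists x, (x \notin s) && edge a x].
    by exists a, x.
  rewrite negb_exists => /forallP noE.
  have s_closed : closed (@edge G) (mem s).
    apply: intro_closed; first exact/sym_connect_sym/edge_sym.
    move=> u v uv us; have := noE u; rewrite negb_and us /= negb_exists.
    by move/forallP/(_ v); rewrite uv andbT negbK.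
  by have := closed_connect s_closed (G_conn r y); rewrite /= rs (negPf ys).
exists (rcons s x).
have sub_inner : subrel (connect (inner s)) (connect (inner (rcons s x))).
  apply: connect_sub => u v /and3P[uv us vs]; apply: connect1.
  by rewrite /= uv !mem_rcons !inE us vs !orbT.
have idx z : z \in s -> index z (rcons s x) = index z s.
  by move=> zs; rewrite -cats1 index_cat zs.
split.
- by rewrite size_rcons size_s.
- split; first by rewrite rcons_uniq xs.
  by rewrite -nth0 nth_rcons nth0 size_s.
- move=> y; rewrite mem_rcons inE => /predU1P[->|/s_conn/sub_inner//].
  apply: connect_trans (sub_inner _ _ (s_conn a sa)) (connect1 _).
  by rewrite /= ax !mem_rcons !inE eqxx sa orbT.
(* A vertex missing from a list has the size of the list as index, so whatever precedes a member of
   [rcons s x] lies in [s]. *)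
move=> u v z; have idxN w : w \notin s -> size s <= index w (rcons s x).
  by move=> ws; rewrite -cats1 index_cat (negPf ws) leq_addr.
have lt_in w l : l \in rcons s x -> index w (rcons s x) < index l (rcons s x) -> w \in s.
  rewrite -index_mem size_rcons ltnS => l_le w_lt; apply: contraLR w_lt => /idxN.
  by rewrite -leqNgt; apply: leq_trans.
move=> zsx uz vz zu zv; have us := lt_in _ _ zsx zu; have vs := lt_in _ _ zsx zv.
move: zsx uz vz zu zv; rewrite mem_rcons inE => /predU1P[->|zs] uz vz.
  by move=> _ _; apply: (unique_neighbour s_conn xs us vs uz vz).
by rewrite !idx //; apply: s_ord.
Qed.

Lemma tree_order : exists pos : G -> nat,
  [/\ injective pos, forall x, pos r <= pos x & unique_earlier pos].
Proof.
have G_gt0 : 0 < #|G| by apply/card_gt0P; exists r.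
have [|s [size_s [s_uniq s_head] _ s_ord]] := @grow_tree #|G|.-1.
  by rewrite prednK.
have sT x : x \in s.
  have sG : #|s| = #|G| by rewrite (card_uniqP s_uniq) size_s prednK.
  by rewrite (subset_cardP sG (subset_predT _)).
exists (fun x => index x s); split=> [x y|x|x y z]; last exact/s_ord/sT.
  by move=> xy; rewrite -(nth_index x (sT x)) xy nth_index.
by case: s s_head {size_s s_uniq s_ord sT} => //= a s ->; rewrite eqxx.
Qed.

End TreeOrder.

(* Hall's condition holds because each colour is unavailable for at most one
   vertex; one spare vertex or one unconstrained colour makes greedy choices
   succeed. *)
Lemma assign (T C : finType) (bad : T -> C -> bool) (W : {set T}) (D : {set C}) :
    (forall w, w \in W -> exists c, ~~ bad w c) ->
    (forall c w w', c \in D -> w \in W -> w' \in W ->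
       bad w c -> bad w' c -> w = w') ->
    #|D| <= #|W| ->
    [\/ D = set0, #|D| < #|W| |
      exists2 c0, c0 \in D & forall w, w \in W -> ~~ bad w c0] ->
  exists h : T -> option C,
    (forall w, w \in W -> exists2 c, h w = Some c & ~~ bad w c) /\
    (forall c, c \in D -> exists2 w, w \in W & h w = Some c).
Proof.
have [d] := ubnP #|D|; elim: d W D => // d IHd W D D_lt availW uniqD DW slack.
have [D0|Dn0] := eqVneq D set0.
  have /fin_all_exists[h hP] w : exists o : option C,
      w \in W -> exists2 c, o = Some c & ~~ bad w c.
    have [/availW[c wc]|wW] := boolP (w \in W); last by exists None.
    by exists (Some c) => _; exists c.
  by exists h; split=> // c; rewrite D0 inE.
have two c : c \in D -> 1 < #|W| -> exists2 w, w \in W & ~~ bad w c.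
  move=> cD /card_gt1P[w [w' [wW w'W ww']]].
  have [wc|] := boolP (bad w c); last by exists w.
  by exists w' => //; apply: contra ww' => w'c; rewrite (uniqD c w w').
have [c [w [cD wW wc slack']]] : exists c w, [/\ c \in D, w \in W, ~~ bad w c &
    [\/ D :\ c = set0, #|D| < #|W| |
      exists2 c0, c0 \in D :\ c & forall w, w \in W -> ~~ bad w c0]].
  case: slack => [D0|ltDW|[c0 c0D c0N]].
  - by rewrite D0 eqxx in Dn0.
  - have [c cD] := set0Pn _ Dn0; have [|w wW wc] := two c cD.
      by apply: leq_trans ltDW; rewrite ltnS card_gt0.
    by exists c, w; split=> //; constructor 2.
  (* The unconstrained color [c0] is kept for last, when any remaining vertex can take it. *)
  have [Dc|] := eqVneq (D :\ c0) set0.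
    have [w wW] : exists w, w \in W by apply/card_gt0P; apply: leq_trans DW; rewrite card_gt0.
    by exists c0, w; split=> //; [apply: c0N | constructor 1].
  case/set0Pn=> c; rewrite !inE => /andP[cc0 cD]; have [|w wW wc] := two c cD.
    by apply: leq_trans DW; apply/card_gt1P; exists c, c0.
  exists c, w; split=> //; constructor 3; exists c0 => //.
  by rewrite !inE eq_sym cc0.
have [|||||h [h1 h2]] := IHd (W :\ w) (D :\ c).
- by rewrite [#|D|](cardsD1 c) cD in D_lt.
- by move=> w'; rewrite inE => /andP[_ /availW].
- move=> c' w1 w2; rewrite !inE => /andP[_ c'D] /andP[_ w1W] /andP[_ w2W].
  exact: uniqD.
- by move: DW; rewrite (cardsD1 c D) cD (cardsD1 w W) wW.
- case: slack' => [->|ltDW|[c0 c0D c0N]]; first by constructor 1.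
    by constructor 2; move: ltDW; rewrite (cardsD1 c D) cD (cardsD1 w W) wW.
  by constructor 3; exists c0 => // w'; rewrite inE => /andP[_ /c0N].
exists (fun w' => if w' == w then Some c else h w'); split=> [w' w'W|c' c'D].
  by case: eqVneq => [->|w'w]; [exists c | apply: h1; rewrite !inE w'w].
have [->|c'c] := eqVneq c' c; first by exists w; rewrite ?eqxx.
have [|w' /setD1P[w'w w'W] hw'] := h2 c'; first by rewrite !inE c'c.
by exists w'; rewrite ?(negPf w'w).
Qed.

Lemma initial_subset (T : finType) (pos : T -> nat) (A : {set T}) t : t <= #|A| ->
  exists B : {set T}, [/\ B \subset A, #|B| = t &
    forall v w, v \in B -> w \in A -> pos w < pos v -> w \in B].
Proof.
elim: t => [_|t IHt ltA]; first by exists set0; rewrite sub0set cards0; split=> // v w; rewrite inE.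
have [B [BA Bt B_init]] := IHt (ltnW ltA).
have [a aP] : exists a, a \in A :\: B.
  by apply/card_gt0P; rewrite cardsD (setIidPr BA) Bt subn_gt0.
case: (@arg_minnP T a (mem (A :\: B)) pos aP) => b /setDP[bA bB] b_min.
exists (b |: B); split; first by rewrite subUset sub1set bA.
  by rewrite cardsU1 bB Bt.
move=> v w; rewrite !inE => vB wA wv; apply/norP=> -[wb wB].
have b_le_w : pos b <= pos w by apply: b_min; apply/setDP.
case/predU1P: vB => [vb|vB]; first by rewrite vb ltnNge b_le_w in wv.
by rewrite (B_init v w) in wB.
Qed.

Lemma labelling (T : finType) (B : {set T}) t : #|B| = t -> 0 < t ->
  exists col : T -> 'I_t,
    {in B &, injective col} /\ forall c, exists2 v, v \in B & col v = c.
Proof.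
move=> <- /card_gt0P[b bB]; exists (enum_rank_in bB); split.
  by move=> x y xB yB; apply: enum_rank_in_inj.
by move=> c; exists (enum_val c); [apply: enum_valP | apply: enum_valK_in].
Qed.

(** * Extending a partial coloring of a tree to a b-coloring *)

Section TreeColoring.
Variables (G : sgraph) (pos : G -> nat) (t : nat) (A B : {set G}).
Variable col : G -> 'I_t.
Hypotheses (pos_inj : injective pos) (pos_uniq : unique_earlier pos).
Hypothesis t_gt1 : 1 < t.
Hypothesis AE : A = [set v : G | t <= #|[set y | edge v y]|].
Hypothesis BA : B \subset A.
Hypothesis B_init : forall v w, v \in B -> w \in A -> pos w < pos v -> w \in B.
Hypotheses (col_inj : {in B &, injective col}).
Hypothesis col_onto : forall c, exists2 v, v \in B & col v = c.
Variable r : G.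
Hypotheses (rB : r \in B) (r_min : forall x, pos r <= pos x).

Let nbh (v : G) := [set y | edge v y].

Let r_lt v : v != r -> pos r < pos v.
Proof. by move=> vr; rewrite ltn_neqAle r_min andbT (inj_eq pos_inj) eq_sym. Qed.

Let edge_pos x y : edge x y -> pos x != pos y.
Proof. by move=> xy; rewrite (inj_eq pos_inj); apply: contraTneq xy => ->; rewrite edge_irrefl. Qed.

(* Either [w] has degree less than [t], or, [B] being initial in [A], all the
   relevant neighbours come before [w], so that there is at most one. *)
Lemma free_color (g : G -> 'I_t) w : w \notin B ->
  exists c, forall y, edge w y -> (y \in B) || (pos y < pos w) -> g y != c.
Proof.
move=> wB; pose X := [set y in nbh w | (y \in B) || (pos y < pos w)].
suff: #|g @: X| < t.
  move=> ltX.
  have : ~~ ([set: 'I_t] \subset g @: X).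
    by apply: contraTN ltX => /subset_leq_card; rewrite cardsT card_ord -leqNgt.
  case/subsetPn=> c _ cX; exists c => y wy yX.
  by apply: contraNneq cX => <-; apply: imset_f; rewrite !inE wy.
apply: leq_ltn_trans (leq_imset_card _ _) _.
have [wA|wA] := boolP (w \in A); last first.
  apply: leq_ltn_trans (subset_leq_card (_ : X \subset nbh w)) _.
    by apply/subsetP=> y; rewrite inE => /andP[].
  by rewrite AE inE -ltnNge in wA.
apply: leq_ltn_trans t_gt1.
have early y : y \in X -> edge y w /\ pos y < pos w.
  rewrite !inE edge_sym => /andP[yw /orP[yB|//]]; split=> //.
  rewrite ltn_neqAle edge_pos // leqNgt; apply: contra wB.
  exact: B_init.
apply/card_le1_eqP => y z /early[yw ltyw] /early[zw ltzw].
exact: pos_uniq zw yw ltzw ltyw.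
Qed.

Let bad (w : G) (c : 'I_t) := [exists y in B, edge w y && (col y == c)].

Let later v : {set G} := [set w in nbh v :\: B | pos v < pos w].

(** The set [D] holds the colors that [v] still lacks. As [v] has degree at least [t] and at most
    one earlier neighbour, [later v] has at least as many vertices as [D], and [assign] applies. *)
Lemma assign_later v : v \in B -> exists h : G -> option 'I_t,
  (forall w, w \in later v -> exists2 c, h w = Some c & ~~ bad w c) /\
  (forall c, c != col v -> (forall y, y \in B -> edge v y -> col y != c) ->
     exists2 w, w \in later v & h w = Some c).
Proof.
move=> vB; pose D := ~: (col v |: col @: (nbh v :&: B)).
have laterP w : w \in later v -> [/\ edge v w, w \notin B & pos v < pos w].
  by rewrite !inE => /andP[/andP[]].
have DP c : c \in D -> c != col v /\ forall y, y \in B -> edge v y -> col y != c.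
  rewrite !inE negb_or => /andP[cv cN]; split=> // y yB vy.
  by apply: contraNneq cN => <-; rewrite imset_f // !inE vy.
suff [h [h1 h2]] : exists h : G -> option 'I_t,
    (forall w, w \in later v -> exists2 c, h w = Some c & ~~ bad w c) /\
    (forall c, c \in D -> exists2 w, w \in later v & h w = Some c).
  exists h; split=> // c cv cN; apply: h2; rewrite !inE negb_or cv /=.
  by apply/imsetP=> -[y]; rewrite !inE => /andP[vy /cN/(_ vy)/eqP yc] /esym.
pose E := [set w in nbh v :\: B | pos w < pos v].
have cardE : #|D| < #|later v| + #|E|.
  have nbhE : nbh v :\: B = later v :|: E.
    apply/setP=> w; rewrite !inE; case: (boolP (edge v w)) => [/edge_pos|_].
      by case: ltngtP => // _ _; rewrite !(andbT, andbF) ?orbF.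
    by rewrite !andbF.
  have cardD : #|D| + #|nbh v :&: B|.+1 = t.
    rewrite -[RHS]card_ord -[RHS](cardsC (col v |: col @: (nbh v :&: B))) addnC.
    congr (_ + _); rewrite cardsU1 -add1n; congr (_ + _).
      case: imsetP => // -[y /setIP[]]; rewrite inE => vy yB /(col_inj vB yB) yv.
      by rewrite -yv edge_irrefl in vy.
    by rewrite card_in_imset // => x y /setIP[_ xB] /setIP[_ yB]; apply: col_inj.
  rewrite -(ltn_add2r #|nbh v :&: B|) -ltnS -addnS cardD ltnS.
  have : t <= #|nbh v| by have := subsetP BA v vB; rewrite AE inE.
  move/leq_trans; apply; rewrite -(cardsID B (nbh v)) nbhE addnC leq_add2r.
  exact: leq_card_setU.
have E_le1 : #|E| <= 1.
  apply/card_le1_eqP => y z; rewrite !inE => /andP[/andP[_ vy] yv] /andP[/andP[_ vz] zv].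
  by apply: (pos_uniq (z := v)); rewrite // edge_sym.
apply: assign.
- move=> w /laterP[_ wB _]; have [c cP] := free_color col wB; exists c.
  apply/existsP=> -[y /and3P[yB wy /eqP yc]].
  by have := cP y wy; rewrite yB yc eqxx => /(_ isT).
(* As [col] is injective on [B], a common forbidden color comes from a common neighbour [y] other
   than [v]. It is later than [w] and [w'], whose only earlier neighbour is [v]; so both are the
   earlier neighbour of [y]. *)
- move=> c w w' cD /laterP[vw _ ltvw] /laterP[vw' _ ltvw'].
  case/existsP=> y /and3P[yB wy /eqP yc] /existsP[y' /and3P[y'B wy' /eqP y'c]].
  have yy' : y' = y by apply: col_inj; rewrite ?yc.
  rewrite {}yy' {y' y'B y'c} in wy'.
  have yv : y <> v by move=> yv; have [/eqP] := DP c cD; rewrite -yc yv.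
  have after u : edge v u -> pos v < pos u -> edge u y -> pos u < pos y.
    move=> vu ltvu uy; rewrite ltn_neqAle edge_pos // leqNgt; apply/negP=> ltyu.
    by apply: yv; apply: (pos_uniq (z := u)); rewrite // edge_sym.
  by apply: (pos_uniq wy wy'); apply: after.
- by rewrite -ltnS; apply: leq_trans cardE _; rewrite -addn1 leq_add2l.
(* If [E] is empty, there is a spare vertex. Otherwise [col r] is lacking and unconstrained: an edge
   from [r] would give [v] a second earlier neighbour besides [p], or some [w] in [later v] a second
   one besides [v]. *)
have [E0|[p]] := set_0Vmem E.
  by constructor 2; rewrite E0 cards0 addn0 in cardE.
rewrite !inE => /andP[/andP[pB vp] ltpv]; constructor 3; exists (col r).
  have vr : v != r by apply: contraTneq ltpv => ->; rewrite -leqNgt.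
  rewrite !inE negb_or (inj_in_eq col_inj) // eq_sym vr /=.
  apply/imsetP=> -[y /setIP[]]; rewrite inE => vy yB /(col_inj rB yB) yr.
  rewrite -{y yB}yr in vy; case/negP: pB.
  rewrite (_ : p = r) //; apply: (pos_uniq (z := v)); rewrite ?r_lt // edge_sym //.
move=> w /laterP[vw wB ltvw]; apply/existsP=> -[y /and3P[yB wy /eqP yc]].
have yr : y = r by apply: col_inj.
rewrite {}yr {y yB yc} in wy.
have wr : w != r by apply: contraNneq wB => ->.
have rv : r = v.
  by apply: (pos_uniq (z := w)); rewrite ?r_lt // edge_sym.
by move: ltpv; rewrite -rv ltnNge r_min.
Qed.

(** The vertices outside [B] are colored by increasing [pos]. The prescriptions [h v] cannot
    conflict, as a vertex has at most one earlier neighbour [v]. *)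
Lemma tree_b_colorable : b_colorable G t.
Proof.
have /fin_all_exists[h hP] v : exists h : G -> option 'I_t, v \in B ->
  (forall w, w \in later v -> exists2 c, h w = Some c & ~~ bad w c) /\
  (forall c, c != col v -> (forall y, y \in B -> edge v y -> col y != c) ->
     exists2 w, w \in later v & h w = Some c).
  have [/assign_later[h hP]|vB] := boolP (v \in B); first by exists h.
  by exists (fun _ => None).
have laterP v w : w \in later v -> [/\ edge v w, w \notin B & pos v < pos w].
  by rewrite !inE => /andP[/andP[]].
pose extends k (g : G -> 'I_t) :=
  [/\ {in B, g =1 col},
      forall v w, v \in B -> w \in later v -> pos w < k -> h v w = Some (g w) &
      forall x y, (x \in B) || (pos x < k) -> (y \in B) || (pos y < k) ->
        edge x y -> g x != g y].
have extend k : exists g, extends k g.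
  elim: k => [|k [g [gB gh g_prop]]].
    exists col; split=> // x y; rewrite !ltn0 !orbF => xB yB.
    by apply: contraTneq => /(col_inj xB yB) ->; rewrite edge_irrefl.
  have [/existsP[z /andP[zB /eqP zk]]|noz] :=
    boolP [exists z, (z \notin B) && (pos z == k)]; last first.
    have ltS x : x \notin B -> (pos x < k.+1) = (pos x < k).
      move=> xB; rewrite ltnS leq_eqVlt; case: eqP => // xk; case/negP: noz.
      by apply/existsP; exists x; rewrite xB xk eqxx.
    have ltBS x : (x \in B) || (pos x < k.+1) = (x \in B) || (pos x < k).
      by have [//|xB] := boolP (x \in B); rewrite /= ltS.
    exists g; split=> // [v w vB wv|x y].
      by rewrite ltS; [apply: gh | case: (laterP v w wv)].
    by rewrite !ltBS; apply: g_prop.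
  (* If [z] has a prescribed color, its earlier neighbour [p] is in [B], so all its colored
     neighbours are, and a color that is not [bad] is safe. Otherwise [free_color] provides one. *)
  have [c [c_free c_h]] : exists c,
      (forall y, edge z y -> (y \in B) || (pos y < pos z) -> g y != c) /\
      (forall v, v \in B -> z \in later v -> h v z = Some c).
    have [/existsP[p /andP[pB zp]]|] := boolP [exists p in B, z \in later p].
      have [pz _ ltpz] := laterP p z zp.
      have [c hc cN] := (hP p pB).1 z zp; exists c.
      have pE y : edge y z -> pos y < pos z -> y = p.
        by move=> yz ltyz; apply: pos_uniq yz pz ltyz ltpz.
      split=> [y zy yP|v vB /laterP[vz _ ltvz]]; last by rewrite (pE v).
      have yB : y \in B by case/orP: yP => // ltyz; rewrite (pE y) // edge_sym.
      rewrite gB //; apply: contraNneq cN => yc; apply/existsP; exists y.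
      by rewrite yB zy yc eqxx.
    rewrite negb_exists => /forallP noP; have [c cP] := free_color g zB.
    exists c; split=> // v vB zv; have := noP v; by rewrite vB zv.
  exists (fun x => if x == z then c else g x).
  have ltS x : x != z -> (pos x < k.+1) = (pos x < k).
    by move=> xz; rewrite ltnS leq_eqVlt -zk (inj_eq pos_inj) (negPf xz).
  split=> [x xB|v w vB wv|x y].
  - by rewrite ifN ?gB //; apply: contraNneq zB => <-.
  - case: eqVneq => [wz _|wz]; first by rewrite wz in wv *; apply: c_h.
    by rewrite ltS //; apply: gh.
  case: (eqVneq x z) (eqVneq y z) => [->|xz] [->|yz]; rewrite ?edge_irrefl //.
  - by move=> _; rewrite ltS // -zk => yP /c_free; rewrite eq_sym; apply.
  - by rewrite ltS // -zk => xP _; rewrite edge_sym => /c_free; apply.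
  by rewrite !ltS //; apply: g_prop.
have [g [gB gh g_prop]] := extend (\max_x pos x).+1.
have lt_max x : pos x < (\max_x pos x).+1 by rewrite ltnS leq_bigmax.
apply/b_colorableP; exists g => [x y|]; first by apply: g_prop; rewrite lt_max orbT.
apply/setP=> c; rewrite inE; apply/b_colorsP; have [v vB vc] := col_onto c.
exists v; last by rewrite gB.
apply/b_vertP=> d; rewrite gB // => dv.
have [/existsP[y /and3P[yB vy /eqP yd]]|] := boolP (bad v d).
  by exists y; rewrite ?gB.
rewrite negb_exists => /forallP vN; have [|w wv hw] := (hP v vB).2 d dv.
  by move=> y yB vy; have := vN y; rewrite yB vy.
exists w; first by case: (laterP v w wv).
by apply: Some_inj; rewrite -hw gh.
Qed.

End TreeColoring.

(** * Trees, and the induction on tree-cographs *)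

Lemma b_step_tree (G : sgraph) : is_tree G -> b_step G.
Proof.
move=> [G_gt0 G_conn G_acyc] t /colorableP[g g_prop] /b_colorableP[f f_prop fT].
(* With at most one color, every vertex is a b-vertex. The other case leaves a free color beside
   that of a single earlier neighbour. *)
have [t_gt1|t_le1] := ltnP 1 t; last first.
  have ord_eq (c d : 'I_t) : c = d.
    by apply: val_inj; case: t t_le1 c d {g g_prop f f_prop fT} => [|[]] // _ [[]] // ? [[]].
  have /card_gt0P[x _] := G_gt0.
  apply/b_colorableP; exists g => //; apply/setP=> c; rewrite inE; apply/b_colorsP.
  by exists x => //; apply/b_vertP=> d; rewrite (ord_eq d (g x)) eqxx.
pose A := [set v : G | t <= #|[set y | edge v y]|].
have ltA : t < #|A|.
  rewrite -[t.+1]card_ord -cardsT; apply: leq_trans (leq_imset_card f A).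
  rewrite -fT; apply/subset_leq_card/subsetP=> c /b_colorsP[x /b_vertP bx <-].
  apply: imset_f; rewrite inE -ltnS.
  have sub : [set: 'I_t.+1] \subset f x |: f @: [set y | edge x y].
    apply/subsetP=> d _; rewrite in_setU1; have [//|/bx[y xy <-]] := eqVneq d (f x).
    by apply: imset_f; rewrite inE.
  have := leq_trans (subset_leq_card sub) (leq_card_setU _ _).
  rewrite cardsT card_ord cards1 => /leq_trans; apply.
  by rewrite add1n ltnS leq_imset_card.
have [r rA] : exists r, r \in A by apply/card_gt0P; apply: leq_ltn_trans ltA.
have [pos [pos_inj r_min pos_uniq]] := tree_order r G_conn G_acyc.
have [B [BA Bt B_init]] := initial_subset pos (ltnW ltA).
have t_gt0 := ltnW t_gt1.
have [col [col_inj col_onto]] := labelling Bt t_gt0.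
(* [r] lies in [A] and precedes all other vertices, so the initial set [B] contains it. *)
have rB : r \in B.
  have [v vB] : exists v, v \in B by apply/card_gt0P; rewrite Bt.
  have [<-//|vr] := eqVneq v r; apply: B_init vB rA _.
  by rewrite ltn_neqAle r_min andbT (inj_eq pos_inj) eq_sym.
exact: (tree_b_colorable pos_inj pos_uniq t_gt1 erefl BA B_init col_inj col_onto rB r_min).
Qed.

Lemma b_step_tree_cograph (G : sgraph) : tree_cograph G -> b_step G.
Proof.
elim=> {}G.
- exact: b_step_tree.
- move=> [_ _ G_acyc]; apply: b_step_cotriangle_free => x y z xy yz; apply/negP=> xz.
  have [xy' _] := andP xy; have [yz' _] := andP yz; have [xz' _] := andP xz.
  (* A triangle of the complement is a cycle on three vertices. *)
  have /G_acyc // : ucycle (@edge (compl G)) [:: x; y; z].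
  by rewrite /ucycle /= xy yz compl_sym xz !inE negb_or xy' xz' yz'.
- by move=> G1 G2 _ step1 _ step2 /iso_b_step; apply; apply: b_step_union.
by move=> G1 G2 _ step1 _ step2 /iso_b_step; apply; apply: b_step_join.
Qed.

Theorem theorem18 (G : sgraph) (hG : tree_cograph G) : b_continuous G.
Proof. exact/b_step_continuous/b_step_tree_cograph. Qed.
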